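(* Let $1\le p\le n$, let $f:\mathbb{C}^{n\times n}\to\mathbb{R}$ be smooth, and let $F(Y)=f(YY^* )$ for $Y\in\mathbb{C}^{n\times p}$. Consider the Riemannian conjugate gradient method (RCG) on the quotient manifold $\mathbb{C}^{n\times p}_*/\mathcal{O}_p$ endowed with the metric induced by $g^1$, using the retraction $R_{\pi(Y)}(\eta_{\pi(Y)})=\pi(Y+\overline{\eta}_Y)$ and the vector transport whose horizontal lift at $Y+\overline\eta_Y$ is $P^{\mathcal{H}^1}_{Y+\overline{\eta}_Y}(\overline{\xi}_Y)$, and consider the (Euclidean) nonlinear conjugate gradient method applied directly to the unconstrained problem $\min_{Y\in\mathbb{C}^{n\times p}}F(Y)$; both methods are written out in the context. If both methods are started from the same initial point $Y_0\in\mathbb{C}^{n\times p}_*$ (with the same tolerance and the same rule for the initial steps), then they produce exactly the same iterates $Y_k$, as long as the iterates of RCG are defined (in particular have full rank $p$).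
   Context: Complex matrix spaces are real vector spaces with inner product $\langle A,B\rangle=\Re(\mathrm{tr}(A^*B))$. $\mathbb{C}^{n\times p}_*$ is the open set of rank-$p$ matrices in $\mathbb{C}^{n\times p}$, $\mathcal{O}_p=\{O\in\mathbb{C}^{p\times p}:O^*O=OO^*=I\}$ acts by $Y\mapsto YO$, and $\pi:\mathbb{C}^{n\times p}_*\to\mathbb{C}^{n\times p}_*/\mathcal{O}_p$ is the projection. The metric $g^1$ is $g^1_Y(A,B)=\Re(\mathrm{tr}(A^*B))$. The vertical space is $\mathcal{V}_Y=\{Y\Omega:\Omega^*=-\Omega\in\mathbb{C}^{p\times p}\}$, the horizontal space is its $g^1$-orthogonal complement $\mathcal{H}^1_Y=\{Z\in\mathbb{C}^{n\times p}:Y^*Z=Z^*Y\}$, and $P^{\mathcal{H}^1}_Y$ is the $g^1$-orthogonal projection of $\mathbb{C}^{n\times p}$ onto $\mathcal{H}^1_Y$. Tangent vectors of the quotient at $\pi(Y)$ are represented by their horizontal lifts in $\mathcal{H}^1_Y$. The cost function on the quotient is $h(\pi(Y))=F(Y)$; the horizontal lift of its Riemannian gradient at $Y$ is the Riemannian gradient $\operatorname{grad}F(Y)$ of $F$ with respect to $g^1$. $\nabla F$ denotes the gradient of $F$ with respect to $\langle\cdot,\cdot\rangle$ on $\mathbb{C}^{n\times p}$. RCG on $(\mathbb{C}^{n\times p}_*/\mathcal{O}_p,g^1)$, in horizontal lifts: start with $Y_0\in\mathbb{C}^{n\times p}_*$, $\overline\xi_0=\operatorname{grad}F(Y_0)$,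 $\overline\eta_0=-\overline\xi_0$, tolerance $\varepsilon>0$. For $k=1,2,\dots$: (1) choose an initial step $t_k$ by a rule depending only on $F$, $Y_{k-1}$, $\overline\eta_{k-1}$ (e.g. $t_k=\arg\min_t F(Y_{k-1}+t\overline\eta_{k-1})$); (2) find the smallest integer $m\ge 0$ with $F(Y_{k-1})-F(Y_{k-1}+0.5^m t_k\overline\eta_{k-1})\ge -0.0001\cdot 0.5^m t_k\, g^1_{Y_{k-1}}(\overline\xi_{k-1},\overline\eta_{k-1})$ and set $\overline\zeta_k=0.5^m t_k\overline\eta_{k-1}$; (3) $Y_k=Y_{k-1}+\overline\zeta_k$; (4) $\overline\xi_k=\operatorname{grad}F(Y_k)$; (5) stop if $\sqrt{g^1_{Y_k}(\overline\xi_k,\overline\xi_k)}<\varepsilon$ or $F(Y_k)<\varepsilon$; (6) $\overline\eta_k=-\overline\xi_k+\beta_k P^{\mathcal{H}^1}_{Y_k}(\overline\eta_{k-1})$ with $$\beta_k=\frac{g^1_{Y_k}\big(\overline\xi_k,\ \overline\xi_k-P^{\mathcal{H}^1}_{Y_k}(\overline\xi_{k-1})\big)}{g^1_{Y_{k-1}}(\overline\xi_{k-1},\overline\xi_{k-1})}.$$ Conjugate gradient method for $\min_{Y}F(Y)$ (Burer--Monteiro CG): the same scheme with $\operatorname{grad}F$ replaced by $\nabla F$, $g^1$ replaced by $\langle\cdot,\cdot\rangle$, and no projections, i.e. $\eta_k=-\nabla F(Y_k)+\beta_k\eta_{k-1}$ with $\beta_k=\langle\nabla F(Y_k),\nabla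 F(Y_k)-\nabla F(Y_{k-1})\rangle/\langle\nabla F(Y_{k-1}),\nabla F(Y_{k-1})\rangle$, with the same initial-step rule, Armijo backtracking and stopping test. *)

(* Defs.v *)
From HB Require Import structures.
From mathcomp Require Import all_boot all_order all_algebra.
From mathcomp Require Import sesquilinear spectral.
From mathcomp Require Import complex.
From mathcomp Require Import all_classical all_reals all_analysis.

Set Implicit Arguments.
Unset Strict Implicit.
Unset Printing Implicit Defensive.

Import Order.TTheory GRing.Theory Num.Theory.
Import numFieldNormedType.Exports.

Local Open Scope classical_set_scope.
Local Open Scope ring_scope.
Local Open Scope complex_scope.
Local Open Scope sesquilinear_scope.

(** * Complex matrices as a real vector space *)

Notation Cmx R m n := 'M[complex (Real.sort R)]_(m, n).

(** MathComp-Analysis makes ['M[R[i]]_(m, n)] a normed space over [R[i]] only.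
    Real differentiation is therefore done in the coordinates
    [Y |-> (Re Y, Im Y)], in the real normed space of pairs of real matrices. *)
Definition of_reim (R : realType) m n
    (Z : ('M[R]_(m, n) * 'M[R]_(m, n))%type) : Cmx R m n :=
  \matrix_(i, j) (Z.1 i j +i* Z.2 i j).

Definition reim (R : realType) m n (Y : Cmx R m n) :
    ('M[R]_(m, n) * 'M[R]_(m, n))%type :=
  (map_mx (@complex.Re R) Y, map_mx (@complex.Im R) Y).

Lemma reimK (R : realType) m n : cancel (@reim R m n) (@of_reim R m n).
Proof. by move=> Y; apply/matrixP => i j; rewrite !mxE; case: (Y i j). Qed.

Lemma of_reimK (R : realType) m n : cancel (@of_reim R m n) (@reim R m n).
Proof. by case=> A B; congr pair; apply/matrixP => i j; rewrite !mxE. Qed.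

(** [C^oo]: every iterated directional derivative of [f] is Frechet
    differentiable at every point (so all differentials of all orders exist). *)
Definition smooth (R : realType) (V : normedModType R) (f : V -> R^o) : Prop :=
  forall (vs : seq V) (x : V),
    differentiable (foldr (fun v (h : V -> R^o) => 'D_v h) f vs) x.

Definition Csmooth (R : realType) m n (f : Cmx R m n -> R) : Prop :=
  smooth (f \o @of_reim R m n : _ -> R^o).

(** [dF(Y)[H]], the real differential. *)
Definition Rdiff (R : realType) m n (F : Cmx R m n -> R) (Y H : Cmx R m n) : R :=
  'd (F \o @of_reim R m n : _ -> R^o) (reim Y) (reim H).

Definition inner (R : realType) m n (A B : Cmx R m n) : R :=
  complex.Re (\tr (A^t* *m B)).

(** [nabla F Y] is the vector representing [dF(Y)] for [inner]. *)
Definition nabla (R : realType) m n (F : Cmx R m n -> R) (Y : Cmx R m n) :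
    Cmx R m n :=
  xget 0 [set G | forall H, Rdiff F Y H = inner G H].

(** The tangent space at every point of the open set of rank-[p] matrices is
    the whole of [Cmx R n p]; a metric is a family of inner products on it. *)
Definition Rgrad (R : realType) m n (g : Cmx R m n -> Cmx R m n -> Cmx R m n -> R)
    (F : Cmx R m n -> R) (Y : Cmx R m n) : Cmx R m n :=
  xget 0 [set G | forall H, Rdiff F Y H = g Y G H].

(** * Geometry of the quotient, in horizontal lifts *)

Definition full_rank (R : realType) n p (Y : Cmx R n p) : bool := \rank Y == p.

Definition g1 (R : realType) n p (Y A B : Cmx R n p) : R :=
  complex.Re (\tr (A^t* *m B)).

Definition vertical (R : realType) n p (Y : Cmx R n p) : set (Cmx R n p) :=
  [set Y *m Omega | Omega in [set Omega : Cmx R p p | Omega^t* = - Omega]].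

Definition horizontal1 (R : realType) n p (Y : Cmx R n p) : set (Cmx R n p) :=
  [set Z | forall V, vertical Y V -> g1 Y V Z = 0].

Lemma horizontal1E (R : realType) n p (Y : Cmx R n p) :
  horizontal1 Y = [set Z | Y^t* *m Z = Z^t* *m Y].
Proof.
have Re_conj q (A : Cmx R q q) :
    complex.Re (\tr (A^t*)) = complex.Re (\tr A).
  rewrite /mxtrace !raddf_sum; apply: eq_bigr => i _.
  by rewrite !mxE; case: (A i i).
have Re0 q (A : Cmx R q q) : complex.Re (\tr (A^t* *m A)) = 0 -> A = 0.
  have -> : complex.Re (\tr (A^t* *m A)) =
      \sum_i \sum_j (complex.Re (A j i) ^+ 2 + complex.Im (A j i) ^+ 2).
    rewrite /mxtrace raddf_sum; apply: eq_bigr => i _.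
    rewrite mxE raddf_sum; apply: eq_bigr => j _.
    by rewrite !mxE; case: (A j i) => a b /=; rewrite !expr2 mulNr opprK.
  have pos i j : 0 <= complex.Re (A j i) ^+ 2 + complex.Im (A j i) ^+ 2.
    by rewrite addr_ge0 ?sqr_ge0.
  move=> /eqP; rewrite psumr_eq0 => [/allP h|i _]; last exact: sumr_ge0.
  apply/matrixP => j i; rewrite mxE.
  have := h i (mem_index_enum _); rewrite psumr_eq0 // => /allP /(_ j).
  rewrite mem_index_enum => /(_ isT).
  rewrite paddr_eq0 ?sqr_ge0 // !sqrf_eq0.
  by case: (A j i) => a b /= /andP[/eqP -> /eqP ->].
apply/seteqP; split => Z /=; last first.
  move=> YZ V; case=> W /= sk <-; rewrite /g1 trmx_mul map_mxM /= -mulmxA sk.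
  set M := Y^t* *m Z.
  have MH : M^t* = M by rewrite /M trmx_mul map_mxM /= trmxCK -YZ.
  have : complex.Re (\tr (W *m M)) = - complex.Re (\tr (W *m M)).
    rewrite -[LHS]Re_conj trmx_mul map_mxM /= MH sk mulmxN !raddfN /=.
    by rewrite mxtrace_mulC.
  by rewrite mulNmx !raddfN /= => /eqP; rewrite -addr_eq0 -mulr2n mulrn_eq0
    => /eqP ->; rewrite oppr0.
move=> hZ; set M := Y^t* *m Z.
have -> : Z^t* *m Y = M^t* by rewrite /M trmx_mul map_mxM /= trmxCK.
pose Omega := M - M^t*.
have sk : Omega^t* = - Omega.
  by rewrite /Omega linearB /= map_mxB /= trmxCK opprB.
apply/eqP; rewrite -subr_eq0; apply/eqP/Re0; rewrite -/Omega.
have OM : complex.Re (\tr (Omega^t* *m M)) = 0.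
  rewrite -[RHS](hZ (Y *m Omega)); last by exists Omega.
  by rewrite /g1 trmx_mul map_mxM /= mulmxA.
have OM' : complex.Re (\tr (Omega^t* *m M^t*)) = 0.
  rewrite -[LHS]Re_conj trmx_mul map_mxM /= !trmxCK mxtrace_mulC.
  by move/eqP: OM; rewrite sk mulNmx !raddfN /= oppr_eq0 => /eqP.
have -> : Omega^t* *m Omega = Omega^t* *m M - Omega^t* *m M^t*.
  by rewrite -mulmxBr.
by rewrite (raddfB (@mxtrace _ _)) (raddfB (@complex.Re R)) /= OM OM' subr0.
Qed.

Definition projH1 (R : realType) n p (Y Z : Cmx R n p) : Cmx R n p :=
  xget 0 [set W | horizontal1 Y W /\
                  forall V, horizontal1 Y V -> g1 Y (Z - W) V = 0].

(** * Nonlinear conjugate gradients *)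

(** What distinguishes the two methods.  [cg_transport G Y zeta xi] carries [xi]
    from [Y] to [cg_retraction G Y zeta]. *)
Record cg_geometry (R : realType) n p := CgGeometry {
  cg_domain : Cmx R n p -> bool;
  cg_metric : Cmx R n p -> Cmx R n p -> Cmx R n p -> R;
  cg_gradient : (Cmx R n p -> R) -> Cmx R n p -> Cmx R n p;
  cg_retraction : Cmx R n p -> Cmx R n p -> Cmx R n p;
  cg_transport : Cmx R n p -> Cmx R n p -> Cmx R n p -> Cmx R n p }.

Definition quotient_geometry (R : realType) n p : cg_geometry R n p := {|
  cg_domain := @full_rank R n p;
  cg_metric := @g1 R n p;
  cg_gradient := Rgrad (@g1 R n p);
  cg_retraction := fun Y eta => Y + eta;
  cg_transport := fun Y eta xi => projH1 (Y + eta) xi |}.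

Definition euclidean_geometry (R : realType) n p : cg_geometry R n p := {|
  cg_domain := xpredT;
  cg_metric := fun _ => @inner R n p;
  cg_gradient := @nabla R n p;
  cg_retraction := fun Y eta => Y + eta;
  cg_transport := fun _ _ xi => xi |}.

(** The rule choosing [t_k] from [F], [Y_(k-1)] and [eta_(k-1)]; [None] when
    the rule yields no step (for instance when a minimiser does not exist). *)
Definition step_rule (R : realType) n p :=
  (Cmx R n p -> R) -> Cmx R n p -> Cmx R n p -> option R.

Definition least_nat (P : nat -> Prop) : option nat :=
  if pselect (exists m, P m /\ forall j, (j < m)%N -> ~ P j) is left ex
  then Some (projT1 (cid ex)) else None.

Definition armijo (R : realType) n p (G : cg_geometry R n p)
    (F : Cmx R n p -> R) (Y xi eta : Cmx R n p) (t : R) : option nat :=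
  least_nat (fun m =>
    F Y - F (cg_retraction G Y ((2^-1 ^+ m * t)%:C *: eta)) >=
      - (10 ^- 4 * 2^-1 ^+ m * t * cg_metric G Y xi eta)).

(** An iterate [Y_k] with its gradient [xi_k] and the next search direction
    [eta_k], which is [None] if the method stops at [Y_k]. *)
Record cg_state (R : realType) n p := CgState {
  iterate : Cmx R n p;
  gradient_at : Cmx R n p;
  direction : option (Cmx R n p) }.

Definition stopped (R : realType) n p (s : cg_state R n p) : bool :=
  ~~ isSome (direction s).

Definition stop_test (R : realType) n p (G : cg_geometry R n p)
    (F : Cmx R n p -> R) (eps : R) (Y xi : Cmx R n p) : bool :=
  (Num.sqrt (cg_metric G Y xi xi) < eps) || (F Y < eps).

(** Passage from iterate [k-1] to iterate [k]; [None] when iterate [k] does not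
    exist, i.e. when the method has stopped at iterate [k-1], when [t_k] or [m]
    does not exist, or when [Y_k] leaves the domain. *)
Definition cg_step (R : realType) n p (G : cg_geometry R n p)
    (rule : step_rule R n p) (F : Cmx R n p -> R) (eps : R)
    (s : cg_state R n p) : option (cg_state R n p) :=
  let Y := iterate s in
  let xi := gradient_at s in
  if direction s is Some eta then
    if rule F Y eta is Some t then
      if armijo G F Y xi eta t is Some m then
        let zeta := (2^-1 ^+ m * t)%:C *: eta in
        let Y' := cg_retraction G Y zeta in
        let xi' := cg_gradient G F Y' in
        let beta := cg_metric G Y' xi' (xi' - cg_transport G Y zeta xi)
                    / cg_metric G Y xi xi in
        if cg_domain G Y' then
          Some (CgState Y' xi'
            (if stop_test G F eps Y' xi' then None
             else Some (- xi' + beta%:C *: cg_transport G Y zeta eta)))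
        else None
      else None
    else None
  else None.

Definition cg_run (R : realType) n p (G : cg_geometry R n p)
    (rule : step_rule R n p) (F : Cmx R n p -> R) (eps : R)
    (Y0 : Cmx R n p) (k : nat) : option (cg_state R n p) :=
  let xi0 := cg_gradient G F Y0 in
  iter k (obind (cg_step G rule F eps))
    (if cg_domain G Y0 then Some (CgState Y0 xi0 (Some (- xi0))) else None).

Definition RCG (R : realType) n p := cg_run (quotient_geometry R n p).

Definition CG (R : realType) n p := cg_run (euclidean_geometry R n p).

(* Main.v *)
(** [F] is constant along the orbits [Y U], so its Euclidean gradient is
    horizontal and coincides with the [g1]-gradient.  Horizontality of a
    direction [eta] at [Y] means that [Y^* eta] is Hermitian, a property that
    survives the step [Y + t eta] because [eta^* eta] is Hermitian; hence the
    projection fixes the transported search direction.  In [beta_k] the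
    projected old gradient is paired with a horizontal vector, so the projection
    may be dropped there too.  The projection is well defined at full rank, the
    vertical component [Y X] of [Z] being given by the Lyapunov equation
    [Y^* Y X + X Y^* Y = Y^* Z - Z^* Y]. *)

Require Import Defs.
From HB Require Import structures.
From mathcomp Require Import all_boot all_order all_algebra.
From mathcomp Require Import sesquilinear spectral.
From mathcomp Require Import complex.
From mathcomp Require Import all_classical all_reals all_analysis.
Import Order.TTheory GRing.Theory Num.Theory.
Import numFieldNormedType.Exports.
Local Open Scope ring_scope.
Local Open Scope sesquilinear_scope.

(** * The real inner product on complex matrices *)

Section InnerProduct.
Context {R : realType} {m n : nat}.
Implicit Types A B C : Cmx R m n.

Lemma trmxCM p q r (A : Cmx R p q) (B : Cmx R q r) :
  (A *m B)^t* = B^t* *m A^t*.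
Proof. by rewrite trmx_mul map_mxM. Qed.

Lemma trmxCZ (a : R) p q (A : Cmx R p q) :
  (a%:C%C *: A)^t* = a%:C%C *: A^t*.
Proof. by rewrite linearZ map_mxZ; congr (_ *: _); exact: conjc_real. Qed.

Lemma mxtrace_trmxC p (A : Cmx R p p) : \tr (A^t*) = (\tr A)^*.
Proof.
rewrite -mxtrace_tr -map_trmx trmxK /mxtrace rmorph_sum.
by apply: eq_bigr => i _; rewrite mxE.
Qed.

Lemma innerC A B : inner A B = inner B A.
Proof.
rewrite /inner -[in RHS](trmxCK A) -trmxCM mxtrace_trmxC.
by case: (\tr _).
Qed.

Lemma innerDr A B C : inner A (B + C) = inner A B + inner A C.
Proof. by rewrite /inner mulmxDr !raddfD. Qed.

Lemma innerNr A B : inner A (- B) = - inner A B.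
Proof. by rewrite /inner mulmxN !raddfN. Qed.

Lemma innerBr A B C : inner A (B - C) = inner A B - inner A C.
Proof. by rewrite innerDr innerNr. Qed.

Lemma innerZr (a : R) A B : inner A (a%:C%C *: B) = a * inner A B.
Proof.
rewrite /inner -scalemxAr linearZ /=; case: (\tr _) => x y /=.
by rewrite mul0r subr0.
Qed.

Lemma inner0r A : inner A 0 = 0.
Proof. by rewrite /inner mulmx0 !raddf0. Qed.

Lemma mxtrace_gramE A : \tr (A^t* *m A) = \sum_j \sum_i `|A i j| ^+ 2.
Proof.
apply: eq_bigr => j _; rewrite mxE; apply: eq_bigr => i _.
by rewrite !mxE normCKC.
Qed.

Lemma mxtrace_gram_ge0 A : 0 <= \tr (A^t* *m A).
Proof.
rewrite mxtrace_gramE; do 2!apply: sumr_ge0 => ? _.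
by apply: exprn_ge0; exact: normr_ge0.
Qed.

Lemma mxtrace_gram_eq0 A : \tr (A^t* *m A) = 0 -> A = 0.
Proof.
rewrite mxtrace_gramE => /eqP.
rewrite psumr_eq0 => [/allP A0|j _]; last first.
  by apply: sumr_ge0 => i _; apply: exprn_ge0; exact: normr_ge0.
apply/matrixP => i j; rewrite mxE; apply/eqP.
have := A0 j (mem_index_enum _); rewrite psumr_eq0 => [/allP/(_ i)|k _].
  by rewrite mem_index_enum sqrf_eq0 normr_eq0; apply.
by apply: exprn_ge0; exact: normr_ge0.
Qed.

(** Being nonnegative in the order of the complex numbers, the trace of [A^t* *m A] has zero
    imaginary part, so it vanishes as soon as its real part does. *)
Lemma inner_eq0 A : inner A A = 0 -> A = 0.
Proof.
move=> A0; apply: mxtrace_gram_eq0; move: A0 (mxtrace_gram_ge0 A).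
by rewrite /inner; case: (\tr _) => x y /= ->; rewrite lecE /= => /andP[/eqP -> _].
Qed.

End InnerProduct.

(** * Horizontal vectors and the horizontal projection *)

Section Horizontal.
Context {R : realType} {n p : nat}.
Implicit Types Y Z V W : Cmx R n p.

Lemma horizontal1D Y Z W :
  horizontal1 Y Z -> horizontal1 Y W -> horizontal1 Y (Z + W).
Proof.
move=> hZ hW V vV.
by rewrite [LHS]innerDr [inner _ _]hZ// [inner _ _]hW// addr0.
Qed.

Lemma horizontal1N Y Z : horizontal1 Y Z -> horizontal1 Y (- Z).
Proof. by move=> hZ V vV; rewrite [LHS]innerNr [inner _ _]hZ// oppr0. Qed.

Lemma horizontal1Z Y (a : R) Z : horizontal1 Y Z -> horizontal1 Y (a%:C%C *: Z).
Proof. by move=> hZ V vV; rewrite [LHS]innerZr [inner _ _]hZ// mulr0. Qed.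

Lemma horizontal1_line Y (a : R) Z :
  horizontal1 Y Z -> horizontal1 (Y + a%:C%C *: Z) Z.
Proof.
rewrite !horizontal1E /= => YZ.
rewrite linearD /= map_mxD mulmxDl mulmxDr YZ; congr (_ + _).
by rewrite trmxCZ -scalemxAl -scalemxAr.
Qed.

(* [<X, G X + X G> = |Y X|^2 + |Y X^*|^2] for [G = Y^* Y]. *)
Lemma lyapunov_gram_inj Y (X : Cmx R p p) : full_rank Y ->
  Y^t* *m Y *m X + X *m (Y^t* *m Y) = 0 -> X = 0.
Proof.
move=> /eqP rY YX.
have : \tr ((Y *m X)^t* *m (Y *m X)) + \tr ((Y *m X^t*)^t* *m (Y *m X^t*)) = 0.
  transitivity (\tr (X^t* *m (Y^t* *m Y *m X + X *m (Y^t* *m Y)))).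
    rewrite mulmxDr mxtraceD !trmxCM trmxCK !mulmxA; congr (_ + _).
    by rewrite mxtrace_mulC !mulmxA.
  by rewrite YX mulmx0 mxtrace0.
move/eqP; rewrite paddr_eq0 ?mxtrace_gram_ge0// => /andP[/eqP/mxtrace_gram_eq0 YX0 _].
by apply: (@row_full_inj _ _ _ _ Y); rewrite ?mulmx0// /row_full rY.
Qed.

(** An injective endomorphism of a finite-dimensional space is onto; [L] is the matrix of the
    Lyapunov operator acting on vectorised matrices. *)
Lemma lyapunov_gram_surj Y (B : Cmx R p p) : full_rank Y ->
  exists X : Cmx R p p, Y^t* *m Y *m X + X *m (Y^t* *m Y) = B.
Proof.
move=> rY; set G := Y^t* *m Y.
pose L := lin_mulmx G + lin_mulmxr G.
have LE X : mxvec X *m L = mxvec (G *m X + X *m G).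
  by rewrite mulmxDr !mul_vec_lin linearD.
have Lu : L \in unitmx.
  rewrite -row_free_unit; apply: inj_row_free => v; rewrite -(vec_mxK v) LE.
  move/(congr1 vec_mx); rewrite mxvecK linear0 => /(lyapunov_gram_inj _ _ rY) ->.
  by rewrite linear0.
exists (vec_mx (mxvec B *m invmx L)); apply: (can_inj mxvecK).
by rewrite -LE vec_mxK mulmxKV.
Qed.

Lemma horizontal1_decomposition Y Z : full_rank Y ->
  exists2 V, vertical Y V & horizontal1 Y (Z - V).
Proof.
move=> rY; pose B := Y^t* *m Z - Z^t* *m Y.
have skB : B^t* = - B.
  by rewrite /B linearB /= map_mxB /= !trmxCM !trmxCK opprB.
have [X XB] := lyapunov_gram_surj _ B rY; set G := Y^t* *m Y in XB.
have GH : G^t* = G by rewrite trmxCM trmxCK.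
(* As [G] is Hermitian and [B] skew-Hermitian, adding the equation to its adjoint shows that
   [X + X^t*] solves the homogeneous equation. *)
have skX : X^t* = - X.
  apply/eqP; rewrite -addr_eq0; apply/eqP/(lyapunov_gram_inj _ _ rY).
  rewrite -/G mulmxDr mulmxDl addrACA XB -{1 2}GH -!trmxCM.
  by rewrite [X in X + _]addrC -map_mxD -linearD /= XB skB addNr.
exists (Y *m X); first by exists X.
rewrite horizontal1E /= [(_ - _)^T]linearB /= map_mxB mulmxBr mulmxBl trmxCM skX.
rewrite !mulNmx opprK; apply/eqP; rewrite subr_eq -addrA addrC -subr_eq.
by rewrite -/B -XB addrC !mulmxA.
Qed.

(** At full rank the set given to [xget] contains [Z - V], whose residual [V] is vertical, so the
    value is a genuine projection and not the fallback. *)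
Lemma projH1P Y Z : full_rank Y -> horizontal1 Y (projH1 Y Z) /\
  forall V, horizontal1 Y V -> inner (Z - projH1 Y Z) V = 0.
Proof.
move=> rY; have [V vV hV] := horizontal1_decomposition _ Z rY.
apply: (@xgetPex _ 0 [set W | horizontal1 Y W /\
  forall V, horizontal1 Y V -> g1 Y (Z - W) V = 0]%classic).
by exists (Z - V); split=> // U hU; rewrite opprB addrC subrK; apply: hU.
Qed.

(** [Z - projH1 Y Z] is horizontal and orthogonal to all horizontal vectors, hence to itself. *)
Lemma projH1_id Y Z : full_rank Y -> horizontal1 Y Z -> projH1 Y Z = Z.
Proof.
move=> rY hZ; have [hP oP] := projH1P _ Z rY.
apply/esym/eqP; rewrite -subr_eq0; apply/eqP/inner_eq0/oP.
exact/horizontal1D/horizontal1N.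
Qed.

Lemma inner_projH1 Y Z V : full_rank Y -> horizontal1 Y V ->
  inner V (projH1 Y Z) = inner V Z.
Proof.
move=> rY hV; have [_ oP] := projH1P _ Z rY.
by apply/esym/eqP; rewrite -subr_eq0 -innerBr innerC oP.
Qed.

End Horizontal.

(** * The differential of the Gram map *)

Section GramMap.
Context {R : realType} {n p : nat}.
Local Notation V := ('M[R]_(n, p) * 'M[R]_(n, p))%type.
Local Notation W := ('M[R]_(n, n) * 'M[R]_(n, n))%type.

(** Real coordinates on both sides let the real chain rule treat the cost as [f] after this map. *)
Definition gram (Z : V) : W := reim (of_reim Z *m (of_reim Z)^t*).

Lemma differentiable_mx (U : normedModType R) m q (M : U -> 'M[R]_(m, q)) (x : U) :
  (forall i j, differentiable (fun z => M z i j : R^o) x) -> differentiable M x.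
Proof.
move=> dM.
rewrite (_ : M = \sum_i \sum_j fun z => M z i j *: delta_mx i j); last first.
  apply/funext => z; rewrite [LHS]matrix_sum_delta fct_sumE.
  by apply: eq_bigr => i _; rewrite fct_sumE.
by do 2!apply: differentiable_sum => ?; exact: differentiableZl.
Qed.

Lemma gramE (Z : V) :
  gram Z = (\matrix_(i, j) \sum_k (Z.1 i k * Z.1 j k + Z.2 i k * Z.2 j k),
            \matrix_(i, j) \sum_k (Z.2 i k * Z.1 j k - Z.1 i k * Z.2 j k)).
Proof.
congr pair; apply/matrixP => i j; rewrite !mxE raddf_sum; apply: eq_bigr => k _.
  by rewrite !mxE /= mulrN opprK.
by rewrite !mxE /= mulrN addrC.
Qed.

Lemma differentiable_gram (Z : V) : differentiable gram Z.
Proof.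
have d1 i k : differentiable (fun Y : V => Y.1 i k : R^o) Z.
  apply: (@differentiable_comp _ _ _ _ fst (fun M : 'M[R]_(n, p) => M i k : R^o)).
    by apply: (@linear_differentiable _ _ _ fst) => Y; exact: cvg_fst.
  exact: differentiable_coord.
have d2 i k : differentiable (fun Y : V => Y.2 i k : R^o) Z.
  apply: (@differentiable_comp _ _ _ _ snd (fun M : 'M[R]_(n, p) => M i k : R^o)).
    by apply: (@linear_differentiable _ _ _ snd) => Y; exact: cvg_snd.
  exact: differentiable_coord.
rewrite (funext gramE).
apply/differentiable_pair; apply: differentiable_mx => i j.
  rewrite (_ : (fun _ => _) =
    \sum_k (fun Y : V => Y.1 i k * Y.1 j k + Y.2 i k * Y.2 j k : R^o)); last first.
    by apply/funext => Y; rewrite mxE fct_sumE.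
  apply: differentiable_sum => k.
  by apply: differentiableD; apply: differentiableM.
rewrite (_ : (fun _ => _) =
  \sum_k (fun Y : V => Y.2 i k * Y.1 j k - Y.1 i k * Y.2 j k : R^o)); last first.
  by apply/funext => Y; rewrite mxE fct_sumE.
apply: differentiable_sum => k.
by apply: differentiableB; apply: differentiableM.
Qed.

(* The cross term is [H Y^* + Y H^* = Y (X^* + X) Y^* = 0] for [H = Y X]. *)
Lemma gram_vertical (Y H : Cmx R n p) (h : R) : vertical Y H ->
  gram (h *: reim H + reim Y) = gram (reim Y) + h ^+ 2 *: gram (reim H).
Proof.
case=> X skX <-{H}; set H := Y *m X.
have -> : h *: reim H + reim Y = reim (h%:C%C *: H + Y).
  congr pair; apply/matrixP => i j; rewrite !mxE.
    by case: (\sum__ _) => a b; case: (Y i j) => c d /=; rewrite mul0r subr0.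
  by case: (\sum__ _) => a b; case: (Y i j) => c d /=; rewrite mul0r addr0.
rewrite /gram !reimK.
have -> : (h%:C%C *: H + Y) *m (h%:C%C *: H + Y)^t* =
    Y *m Y^t* + (h ^+ 2)%:C%C *: (H *m H^t*).
  have HY : H *m Y^t* = - (Y *m H^t*).
    by rewrite /H trmx_mul map_mxM /= [X^t*]skX mulNmx mulmxN opprK mulmxA.
  rewrite linearD /= map_mxD /= trmxCZ.
  rewrite mulmxDl !mulmxDr -!scalemxAl -!scalemxAr HY scalerN scalerA.
  by rewrite addrA subrK addrC -rmorphM -expr2.
congr pair; apply/matrixP => i j; rewrite !mxE.
  by case: (\sum__ _) => a b; case: (\sum__ _) => c d /=; rewrite mul0r subr0.
by case: (\sum__ _) => a b; case: (\sum__ _) => c d /=; rewrite mul0r addr0.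
Qed.

(** By [gram_vertical] the difference quotient in a vertical direction is [h *: gram (reim H)],
    which tends to 0 with [h]. *)
Lemma diff_gram_vertical (Y H : Cmx R n p) : vertical Y H ->
  'd gram (reim Y) (reim H) = 0.
Proof.
move=> vH; rewrite -deriveE; last exact: differentiable_gram.
apply/cvg_lim => //; apply: (@cvg_trans _ ((fun h : R => h *: gram (reim H)) @ 0^'))%classic.
  apply: near_eq_cvg; near=> h.
  have h0 : h != 0 by near: h; exact: nbhs_dnbhs_neq.
  by rewrite /= gram_vertical// addrC addKr scalerA expr2 mulKf.
have : ((fun h : R => h *: gram (reim H)) @ 0^' --> 0 *: gram (reim H))%classic.
  by apply: cvgZ; [exact: cvg_within|exact: cvg_cst].
by rewrite scale0r.
Unshelve. all: by end_near. Qed.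

Lemma Rdiff_gram_vertical (f : Cmx R n n -> R) (Y H : Cmx R n p) :
  Csmooth f -> vertical Y H -> Rdiff (fun X => f (X *m X^t*)) Y H = 0.
Proof.
move=> sf vH; rewrite /Rdiff.
rewrite (_ : _ \o _ = (f \o @of_reim R n n) \o gram :> (V -> R^o)); last first.
  by apply/funext => Z; rewrite /= /gram reimK.
(* The empty list of directions in [smooth] gives the differentiability of [f] itself. *)
rewrite diff_comp; [|exact: differentiable_gram|exact: (sf [::])].
by rewrite /= diff_gram_vertical// linear0.
Qed.

End GramMap.

Lemma nabla_horizontal (R : realType) (n p : nat) (f : Cmx R n n -> R)
    (Y : Cmx R n p) : Csmooth f ->
  horizontal1 Y (nabla (fun X : Cmx R n p => f (X *m X^t*)) Y).
Proof.
(* If no vector represents the differential, [nabla] is the default 0, which is horizontal too. *)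
move=> sf V vV; rewrite /nabla; case: xgetP => [G _ /= dG|_]; last first.
  exact: inner0r.
by rewrite [LHS]innerC -dG Rdiff_gram_vertical.
Qed.

(** * Equality of the two runs *)

Section Iterates.
Context {R : realType} {n p : nat}.
Variables (f : Cmx R n n -> R) (sf : Csmooth f).
Variables (rule : step_rule R n p) (eps : R).
Let F := fun Y : Cmx R n p => f (Y *m Y^t*).

(** Invariant of the induction on [k]; it holds vacuously once the method has stopped. *)
Definition horizontal_direction (s : cg_state R n p) : Prop :=
  forall eta, direction s = Some eta -> horizontal1 (iterate s) eta.

(** Metrics, gradients and retractions of the two geometries agree by conversion, and so do the
    Armijo and stopping tests; only the domain and the transport call for an argument. *)
Lemma cg_step_quotient_euclidean (s s' : cg_state R n p) :
  horizontal_direction s ->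
  cg_step (quotient_geometry R n p) rule F eps s = Some s' ->
  cg_step (euclidean_geometry R n p) rule F eps s = Some s' /\
  horizontal_direction s'.
Proof.
rewrite /horizontal_direction /cg_step.
case: (direction s) => [eta|//] /(_ eta erefl) heta.
case: (rule _ _ _) => [t|//].
rewrite -[armijo (euclidean_geometry _ _ _) _ _ _ _ _]/(armijo
  (quotient_geometry R n p) F (iterate s) (gradient_at s) eta t).
case: (armijo _ _ _ _ _ _) => [m|//] /=.
set Y' := iterate s + _; rewrite -[Rgrad _ _ _]/(nabla F Y').
(* The quotient domain test supplies the full rank that the projection lemmas require; the Euclidean
   test always succeeds. *)
case: ifP => // rY'.
have hxi : horizontal1 Y' (nabla F Y') by exact: nabla_horizontal.
have heta' : horizontal1 Y' eta by exact: horizontal1_line.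
rewrite -/F (projH1_id _ _ rY' heta').
(* The old gradient may fail to be horizontal at [Y']; its projection disappears only inside the
   pairing with [nabla F Y']. *)
rewrite [g1 _ _ (_ - projH1 _ _)]innerBr inner_projH1// -innerBr.
rewrite -[g1 _ _ _]/(inner (gradient_at s) (gradient_at s)).
rewrite -[stop_test (euclidean_geometry _ _ _) _ _ _ _]/(stop_test
  (quotient_geometry R n p) F eps Y' (nabla F Y')).
move=> [<-]; split=> // zeta /=; case: ifP => // _ [<-].
by apply: horizontal1D; [exact: horizontal1N|exact: horizontal1Z].
Qed.

(** The induction carries equality of whole states, since the next step also reads the old gradient
    and direction. *)
Lemma RCG_CG (Y0 : Cmx R n p) (k : nat) (s : cg_state R n p) :
  RCG rule F eps Y0 k = Some s ->
  CG rule F eps Y0 k = Some s /\ horizontal_direction s.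
Proof.
rewrite /RCG /CG /cg_run; elim: k s => [|k IHk] s.
  rewrite /=; case: ifP => // _ [<-]; split=> // eta /= [<-].
  exact/horizontal1N/nabla_horizontal.
rewrite !iterS; case: (iter k _ _) IHk => [s1|//] /(_ s1 erefl)[-> hs1] /=.
exact: cg_step_quotient_euclidean.
Qed.

End Iterates.

Theorem theorem5p1 (R : realType) (n p : nat) (hp : (1 <= p)%N) (hpn : (p <= n)%N)
    (f : Cmx R n n -> R) (hf : Csmooth f)
    (rule : step_rule R n p) (eps : R) (heps : 0 < eps)
    (Y0 : Cmx R n p) (hY0 : full_rank Y0) :
  let F := fun Y : Cmx R n p => f (Y *m Y^t*) in
  forall (k : nat) (s : cg_state R n p),
    RCG rule F eps Y0 k = Some s ->
    exists s' : cg_state R n p,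
      [/\ CG rule F eps Y0 k = Some s', iterate s' = iterate s
        & stopped s' = stopped s].
Proof.
move=> F k s /(RCG_CG _ hf)[CGs _].
by exists s.
Qed.
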